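(* Fix a time slot $t$ in which the exogenous data $\boldsymbol f^t,\boldsymbol d^t,\boldsymbol v^t_{env},\boldsymbol{\mathcal Y}^t$ (see context) remain constant, and a step size $\alpha>0$. Assume that each $f_i^t$, $i\in\mathcal N$, is continuously differentiable and that $\boldsymbol f^t$ is $m$-strongly convex and $\xi$-smooth on $\boldsymbol{\mathcal Y}^t$, i.e. for all $\boldsymbol x,\boldsymbol y\in\boldsymbol{\mathcal Y}^t$, $$(\nabla \boldsymbol f^t(\boldsymbol x)-\nabla\boldsymbol f^t(\boldsymbol y))^\top(\boldsymbol x-\boldsymbol y)\ge m\|\boldsymbol x-\boldsymbol y\|_2^2,\qquad \|\nabla\boldsymbol f^t(\boldsymbol x)-\nabla\boldsymbol f^t(\boldsymbol y)\|_2\le \xi\|\boldsymbol x-\boldsymbol y\|_2 .$$ Suppose that for every $i\in\mathcal N$ the function $u_{\varphi_i}:=[u_{\varphi_{p,i}},u_{\varphi_{q,i}}]^\top$ satisfies: (C1) $u_{\varphi_i}$ is separable with respect to $v_i$ and $d_i$: $u_{\varphi_i}(v_i,d_i)=u_{\vartheta_i}(v_i)+u_{\phi_i}(d_i)$; (C2) $u_{\vartheta_i}$ is $L_{\vartheta_i}$-Lipschitz continuous: there is a constant $L_{\vartheta_i}>0$ such that $\|u_{\vartheta_i}(v)-u_{\vartheta_i}(v')\|_2\le L_{\vartheta_i}\|v-v'\|_2$ for all $v,v'\in\mathbb R^+$. Then the dynamics $$\boldsymbol x\ \longmapsto\ \left[\boldsymbol x-\alpha\left(\nabla\boldsymbol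 f^t(\boldsymbol x)+\boldsymbol u_{\boldsymbol\varphi}(\mathcal A\boldsymbol x+\boldsymbol v_{env}^t,\boldsymbol d^t)\right)\right]_{\boldsymbol{\mathcal Y}^t}$$ has an equilibrium, and any equilibrium $(\boldsymbol x^{\dagger,t},\boldsymbol v^{\dagger,t})$ must satisfy $$\boldsymbol x^{\dagger,t}=\left[\boldsymbol x^{\dagger,t}-\alpha\left(\nabla\boldsymbol f^t(\boldsymbol x^{\dagger,t})+\boldsymbol u_{\boldsymbol\varphi}(\boldsymbol v^{\dagger,t},\boldsymbol d^t)\right)\right]_{\boldsymbol{\mathcal Y}^t},\qquad \boldsymbol v^{\dagger,t}=\mathcal A\boldsymbol x^{\dagger,t}+\boldsymbol v^t_{env}.$$ Moreover, if $\alpha<\frac{2m}{\xi^2}$ and (C3) $L_{\boldsymbol\vartheta}:=\max_{i\in\mathcal N}L_{\vartheta_i}<\dfrac{1-\sqrt{1-2\alpha m+\alpha^2\xi^2}}{\alpha\|\mathcal A\|_2}$, then the dynamics has a unique equilibrium point.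
   Context: Network: a tree graph with node set $\{0\}\cup\mathcal N$, $\mathcal N=\{1,\dots,N\}$, root $0$, and each line $(i,j)$ having series impedance $r_{ij}+\mathbf i x_{ij}$. $R,X\in\mathbb R^{N\times N}$ have entries $R_{ij}=\sum_{(a,b)\in\mathbb P_{i\wedge j}}2r_{ab}$ and $X_{ij}=\sum_{(a,b)\in\mathbb P_{i\wedge j}}2x_{ab}$, where $\mathbb P_{i\wedge j}$ is the set of lines common to the unique paths from $i$ and from $j$ to the root. $\mathcal A:=[R,X]\in\mathbb R^{N\times 2N}$. Variables and data at time $t$: controllable injections $\boldsymbol x^t=[(\boldsymbol p^t)^\top,(\boldsymbol q^t)^\top]^\top\in\mathbb R^{2N}$, with $\boldsymbol p^t=(p_i^t)_{i}$, $\boldsymbol q^t=(q_i^t)_{i}$; uncontrollable injections $\boldsymbol d^t=[(\boldsymbol p_u^t)^\top,(\boldsymbol q_u^t)^\top]^\top$, with $d_i=(p_{u,i},q_{u,i})$. Squared voltage magnitudes follow the linearized power flow $\boldsymbol v=\mathcal A\boldsymbol x+\boldsymbol v_{env}^t$ with $\boldsymbol v_{env}^t=v_0^t\boldsymbol 1+R\boldsymbol p_u^t+X\boldsymbol q_u^t$, where $v_0^t$ is the given squared voltage magnitude at the root. Being squared voltage magnitudes, the entries of $\boldsymbol v$ are regarded as elements of $\mathbb R^+$ (for $\boldsymbol x\in\boldsymbol{\mathcal Y}^t$). For each $i$, $\mathcal Y_i^t\subset\mathbb R^2$ is a nonempty compact convex set to which $(p_i,q_i)$ is confined (for instance a box $\underline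 p_i^t\le p_i\le\overline p_i^t$, $\underline q_i^t\le q_i\le\overline q_i^t$), and $\boldsymbol{\mathcal Y}^t=\prod_{i\in\mathcal N}\mathcal Y_i^t$, viewed as a subset of $\mathbb R^{2N}$ with coordinates ordered as in $\boldsymbol x$. $[\cdot]_{\boldsymbol{\mathcal Y}^t}$ is Euclidean projection onto $\boldsymbol{\mathcal Y}^t$. $f_i^t(p_i,q_i)$ is the real-valued cost at node $i$, $\boldsymbol f^t=(f^t_i)_{i\in\mathcal N}$, and $\nabla\boldsymbol f^t(\boldsymbol x)\in\mathbb R^{2N}$ stacks $\nabla_{p_i}f_i^t(p_i,q_i)$, $i=1,\dots,N$, followed by $\nabla_{q_i}f_i^t(p_i,q_i)$, $i=1,\dots,N$ (the gradient of $\sum_i f_i^t$). The local feedback policies $u_{\varphi_{p,i}}(v_i,p_{u,i})$ and $u_{\varphi_{q,i}}(v_i,q_{u,i})$ are real-valued, and $\boldsymbol u_{\boldsymbol\varphi}(\boldsymbol v,\boldsymbol d)\in\mathbb R^{2N}$ stacks all $u_{\varphi_{p,i}}(v_i,p_{u,i})$ and then all $u_{\varphi_{q,i}}(v_i,q_{u,i})$. In (C1), $u_{\vartheta_i}$ and $u_{\phi_i}$ are $\mathbb R^2$-valued. The paper's algorithm is $\boldsymbol x^t=[\boldsymbol x^{t-1}-\alpha(\nabla\boldsymbol f^t(\boldsymbol x^{t-1})+\boldsymbol u_{\boldsymbol\varphi}(\hat{\boldsymbol v}^t,\boldsymbol d^t))]_{\boldsymbol{\mathcal Y}^t}$, with $\hat{\boldsymbol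 v}^t=\mathcal A\boldsymbol x^{t-1}+\boldsymbol v_{env}^t$ and resulting voltage $\boldsymbol v^t=\mathcal A\boldsymbol x^t+\boldsymbol v_{env}^t$; with the exogenous data of slot $t$ held constant, an equilibrium is a fixed point $\boldsymbol x^{\dagger,t}$ of the displayed map together with $\boldsymbol v^{\dagger,t}=\mathcal A\boldsymbol x^{\dagger,t}+\boldsymbol v^t_{env}$. $\|\cdot\|_2$ is the Euclidean norm for vectors and the spectral norm for matrices; $m,\xi>0$. *)

(* Defs.v *)
From mathcomp Require Import all_boot all_order all_algebra.
From mathcomp Require Import all_classical all_reals all_analysis.

Set Implicit Arguments.
Unset Strict Implicit.
Unset Printing Implicit Defensive.

Import Order.TTheory GRing.Theory Num.Theory.
Import numFieldNormedType.Exports.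
Local Open Scope classical_set_scope.
Local Open Scope ring_scope.

Section Norms.
Variable R : realType.

(* The library norm on matrices is the max norm; it induces the same topology,
   but the estimates and the projection are Euclidean. *)
Definition norm2 n (v : 'cV[R]_n) : R := Num.sqrt (\sum_i v i 0 ^+ 2).

Definition dot n (u v : 'cV[R]_n) : R := (u^T *m v) 0 0.

Definition spectral_norm m n (A : 'M[R]_(m, n)) : R :=
  sup [set norm2 (A *m v) | v in [set v | norm2 v <= 1]].

Definition is_euclid_proj n (Y : set 'cV[R]_n) (z y : 'cV[R]_n) : Prop :=
  Y y /\ forall y', Y y' -> norm2 (z - y) <= norm2 (z - y').

(* Meaningful for Y nonempty, closed and convex, where the minimizer exists and
   is unique. *)
Definition euclid_proj n (Y : set 'cV[R]_n) (z : 'cV[R]_n) : 'cV[R]_n :=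
  xget 0 (is_euclid_proj Y z).

(* The positive real half-line, the domain of squared voltage magnitudes. *)
Definition pos_reals : set R := [set v | 0 < v].

End Norms.

Section Trees.
Variable V : finType.

Definition simple_graph (e : rel V) : Prop := symmetric e /\ irreflexive e.

(* A two-vertex [ucycle] runs back and forth along one edge, so only those with
   at least three vertices are cycles of the graph. *)
Definition tree (e : rel V) : Prop :=
  [/\ simple_graph e,
      forall a b, connect e a b
    & forall c : seq V, ucycle e c -> (size c <= 2)%N].

(* A path from a is coded, as in [path], by the sequence of its vertices after
   a.  In a tree exactly one sequence satisfies the predicate. *)
Definition tree_path (e : rel V) (a b : V) : seq V :=
  xget [::] [set p | [/\ path e a p, uniq (a :: p) & last a p = b]].

(* A line is an unordered pair of vertices. *)
Definition path_lines (e : rel V) (a b : V) : {set {set V}} :=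
  [set:: [seq [set ab.1; ab.2] |
            ab <- zip (a :: tree_path e a b) (tree_path e a b)]]%SET.

End Trees.

Section Network.
Variables (R : realType) (N : nat).

(* The nodes are 'I_N.+1 with root ord0; i : 'I_N stands for the node i + 1,
   that is, lift ord0 i. *)
Definition root_lines (e : rel 'I_N.+1) (i : 'I_N) : {set {set 'I_N.+1}} :=
  path_lines e (lift ord0 i) ord0.

Definition sens_mx (e : rel 'I_N.+1) (w : {set 'I_N.+1} -> R) : 'M[R]_N :=
  \matrix_(i, j) \sum_(l in root_lines e i :&: root_lines e j) 2 * w l.

Definition net_mx (e : rel 'I_N.+1) (r x : {set 'I_N.+1} -> R) :
    'M[R]_(N, N + N) :=
  row_mx (sens_mx e r) (sens_mx e x).

Definition v_env (e : rel 'I_N.+1) (r x : {set 'I_N.+1} -> R)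
    (v0 : R) (pu qu : 'cV[R]_N) : 'cV[R]_N :=
  const_mx v0 + sens_mx e r *m pu + sens_mx e x *m qu.

Definition pair2 (a b : R) : 'cV[R]_2 := \col_k (if k == 0 then a else b).

(* Vectors of R^{2N} list all first (p) components, then all second (q) ones;
   [node z i] is the pair (p_i, q_i), and [stack] is the inverse operation. *)
Definition node (z : 'cV[R]_(N + N)) (i : 'I_N) : 'cV[R]_2 :=
  pair2 (usubmx z i 0) (dsubmx z i 0).

Definition stack (w : 'I_N -> 'cV[R]_2) : 'cV[R]_(N + N) :=
  col_mx (\col_i w i 0 0) (\col_i w i 1 0).

Definition prod_set (Y : 'I_N -> set 'cV[R]_2) : set 'cV[R]_(N + N) :=
  [set z | forall i, Y i (node z i)].

Definition grad2 (f : 'cV[R]_2 -> R) (z : 'cV[R]_2) : 'cV[R]_2 :=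
  \col_k 'D_(delta_mx k 0) f z.

Definition continuously_differentiable (f : 'cV[R]_2 -> R) : Prop :=
  (forall z : 'cV[R]_2, differentiable f z) /\ continuous (grad2 f).

Definition gradf (f : 'I_N -> 'cV[R]_2 -> R) (z : 'cV[R]_(N + N)) :
    'cV[R]_(N + N) :=
  stack (fun i => grad2 (f i) (node z i)).

Definition strongly_convex (m : R) (f : 'I_N -> 'cV[R]_2 -> R)
    (Y : set 'cV[R]_(N + N)) : Prop :=
  forall x y, Y x -> Y y ->
    m * norm2 (x - y) ^+ 2 <= dot (gradf f x - gradf f y) (x - y).

Definition smooth (xi : R) (f : 'I_N -> 'cV[R]_2 -> R)
    (Y : set 'cV[R]_(N + N)) : Prop :=
  forall x y, Y x -> Y y ->
    norm2 (gradf f x - gradf f y) <= xi * norm2 (x - y).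

(* The policy at one node, as a function of v_i and d_i = (p_{u,i}, q_{u,i}). *)
Definition node_policy (up uq : R -> R -> R) (v : R) (d : 'cV[R]_2) : 'cV[R]_2 :=
  pair2 (up v (d 0 0)) (uq v (d 1 0)).

Definition policy (up uq : 'I_N -> R -> R -> R) (v : 'cV[R]_N)
    (d : 'cV[R]_(N + N)) : 'cV[R]_(N + N) :=
  stack (fun i => node_policy (up i) (uq i) (v i 0) (node d i)).

Definition separable (up uq : R -> R -> R)
    (utheta : R -> 'cV[R]_2) (uphi : 'cV[R]_2 -> 'cV[R]_2) : Prop :=
  forall v d, pos_reals v -> node_policy up uq v d = utheta v + uphi d.

Definition lipschitz_pos (L : R) (u : R -> 'cV[R]_2) : Prop :=
  forall v v', pos_reals v -> pos_reals v' -> norm2 (u v - u v') <= L * `|v - v'|.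

Definition dynamics (alpha : R) (f : 'I_N -> 'cV[R]_2 -> R)
    (up uq : 'I_N -> R -> R -> R) (Y : set 'cV[R]_(N + N))
    (d : 'cV[R]_(N + N)) (A : 'M[R]_(N, N + N)) (venv : 'cV[R]_N)
    (x : 'cV[R]_(N + N)) : 'cV[R]_(N + N) :=
  euclid_proj Y (x - alpha *: (gradf f x + policy up uq (A *m x + venv) d)).

Definition equilibrium (F : 'cV[R]_(N + N) -> 'cV[R]_(N + N))
    (A : 'M[R]_(N, N + N)) (venv : 'cV[R]_N)
    (xv : 'cV[R]_(N + N) * 'cV[R]_N) : Prop :=
  F xv.1 = xv.1 /\ xv.2 = A *m xv.1 + venv.

End Network.

(* Main.v *)
Require Import Defs.
From mathcomp Require Import all_boot all_order all_algebra.

(** The map F of the dynamics is Lipschitz on the compact convex set Y: the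
    gradient is xi-Lipschitz, the voltage-dependent part of the policies is
    Lipschitz at the positive voltages reached from Y, and the projection is
    nonexpansive. Hence F is a continuous self-map of Y, and an equilibrium
    exists by Brouwer's fixed-point theorem ([brouwer]).

    For uniqueness, strong convexity and smoothness bound the expansion of the
    gradient step x - alpha * grad f(x) by sqrt(1 - 2 alpha m + alpha^2 xi^2),
    and the policies contribute at most alpha * L * ||A||, where L is the
    largest of the constants L_i ([dynamics_lipschitz]). The bound assumed on L
    says that the sum of the two factors is less than 1, so F has at most one
    fixed point.

    Brouwer's theorem is proved by the combinatorial method of Petri and
    Voorneveld, a form of Scarf's argument which needs no triangulation. A
    finite set T carries finitely many linear orders; dominant cells with as
    many points as indices (rooms), or one index more (doors), replace the
    simplices and facets of Sperner's lemma, and a parity count gives, for every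
    coloring of T by indices, a room whose colors are exactly its indices
    ([colorful_room]). For T a grid in the standard simplex, ordered by each
    coordinate, rooms are small ([grid_coloring]); coloring x by an index i with
    x_i <= f(x)_i gives approximate fixed points of f, and compactness gives a
    fixed point ([brouwer_simplex]). The case of a compact convex set follows by
    composing with the Euclidean projection. *)

Set Implicit Arguments.
Unset Strict Implicit.
Unset Printing Implicit Defensive.

(** * Dominant cells and colorful rooms *)

(** If A has one point more than its image under f, then f is injective on A up
    to a single colliding pair, and the two points of that pair are those whose
    removal leaves the image unchanged. *)
Lemma card_collision (aT rT : finType) (f : aT -> rT) (A : {set aT}) :
  #|A| = #|f @: A|.+1 -> #|[set a in A | f @: (A :\ a) == f @: A]| = 2.
Proof.
move=> cA.
have : ~~ dinjectiveb f [in A].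
  by apply/dinjectiveP => /card_in_imset fA; move: cA; rewrite fA => /n_Sn.
case/dinjectivePn => a aA [b /andP[/= ba bA] fab].
have drop x y : x \in A -> y \in A -> x != y -> f x = f y ->
    f @: (A :\ x) = f @: A.
  move=> xA yA xy fxy; rewrite -{2}(setD1K xA) imsetU1.
  apply/esym/setUidPr; rewrite sub1set fxy; apply/imset_f.
  by rewrite !inE eq_sym xy.
have -> : 2 = #|[set a; b]| by rewrite cards2 eq_sym ba.
apply: eq_card => x; rewrite !inE.
apply/andP/orP => [[xA /eqP fx]|]; last first.
  case=> /eqP ->; split=> //; apply/eqP.
    by apply: drop bA _ fab => //; rewrite eq_sym.
  exact: drop aA ba (esym fab).
apply/orP; apply: contraT; rewrite negb_or => /andP[xa xb].
have : #|f @: (A :\ x :\ a)| <= #|A :\ x :\ a| by apply: leq_imset_card.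
rewrite (_ : f @: (A :\ x :\ a) = f @: A).
  have := cardsD1 x A; have := cardsD1 a (A :\ x).
  by rewrite !inE aA xA eq_sym xa /= !add1n cA => -> [->]; rewrite ltnn.
rewrite -fx -(setD1K (_ : a \in A :\ x)); last by rewrite !inE aA eq_sym xa.
rewrite imsetU1 setU1K ?inE ?eqxx //; apply/esym/setUidPr; rewrite sub1set fab.
by apply/imset_f; rewrite !inE ba bA eq_sym xb.
Qed.

Section DominantCells.
Variables (T I : finType) (rk : I -> T -> nat).
Hypothesis rk_inj : forall i, injective (rk i).
Implicit Types (s : {set T}) (C D : {set I}) (d r : {set T} * {set I}).

(** The ranking [rk i] is read as the i-th linear order on T; [below i y s] says
    that y is at most every point of s in that order. *)
Definition below i y s := [forall x in s, rk i y <= rk i x].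

(** A cell (s, C) pairs a set of points with a set of indices. It is dominant
    when no point of T exceeds min s strictly in all the orders indexed by C,
    the minimum of the empty set being infinite. *)
Definition dominant d := [forall y, exists i in d.2, below i y d.1].

(** Rooms and doors are the dominant cells that play the role of the full
    simplices and of their facets in Sperner's lemma. *)
Definition room d := dominant d && (#|d.1| == #|d.2|).

Definition door d := dominant d && (#|d.2| == #|d.1|.+1).

(** A door leads into the rooms obtained from it by adding a point or by
    dropping an index (see [adjacentP]); the cardinalities of doors and rooms
    make the two inclusions below say exactly this. *)
Definition adjacent d r := (d.1 \subset r.1) && (r.2 \subset d.2).

Lemma belowP i y s : reflect {in s, forall x, rk i y <= rk i x} (below i y s).
Proof. exact: 'forall_in_idP. Qed.

Lemma dominantP d :
  reflect (forall y, exists2 i, i \in d.2 & below i y d.1) (dominant d).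
Proof. by apply: (iffP forallP) => H y; apply/exists_inP; apply: H. Qed.

Lemma belowS i y s s' : s \subset s' -> below i y s' -> below i y s.
Proof. by move=> /subsetP ss' /belowP H; apply/belowP => x /ss'; apply: H. Qed.

Lemma below_inj i y y' s : y \in s -> y' \in s -> below i y s -> below i y' s ->
  y = y'.
Proof.
move=> ys y's /belowP H /belowP H'; apply: (@rk_inj i); apply/eqP.
by rewrite eqn_leq H ?H'.
Qed.

Lemma dominant_adjacent d r : adjacent d r -> dominant r -> dominant d.
Proof.
case/andP=> sdr /subsetP srd /dominantP domr; apply/dominantP => y.
by have [i /srd id bi] := domr y; exists i => //; apply: belowS sdr bi.
Qed.

Lemma adjacentP d r : #|d.2| = #|d.1|.+1 -> #|r.1| = #|r.2| ->
  reflect ((exists2 y, y \notin d.1 & r = (y |: d.1, d.2)) \/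
           (exists2 k, k \in d.2 & r = (d.1, d.2 :\ k)))
          (adjacent d r).
Proof.
case: d r => [s D] [s' C] /= cD cC; apply: (iffP andP) => /=; last first.
  case=> [[y ys [-> ->]]|[k kD [-> ->]]]; split=> //; first exact: subsetUr.
  by apply/subsetP => l /setD1P[].
case=> ss' CD; have := subset_leq_card ss'.
rewrite leq_eqVlt => /orP[/eqP ess|lt].
  have es : s = s' by apply/eqP; rewrite eqEcard ss' ess leqnn.
  right; have : #|D :\: C| == 1.
    by rewrite cardsD (setIidPr CD) -cC -ess cD subSnn.
  case/cards1P=> k Ek; exists k.
    by have /setDP[] : k \in D :\: C by rewrite Ek set11.
  by rewrite es -Ek setDDr setDv set0U (setIidPr CD).
left; have eC : C = D.
  by apply/eqP; rewrite eqEcard CD cD -cC.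
have : #|s' :\: s| == 1.
  by rewrite cardsD (setIidPr ss') cC eC cD subSnn.
case/cards1P=> y Ey; exists y.
  by have /setDP[] : y \in s' :\: s by rewrite Ey set11.
rewrite eC -Ey; suff es : s' = s' :\: s :|: s by rewrite -es.
apply/setP => z; rewrite !inE.
by have [/(subsetP ss')->|_] := boolP (z \in s); rewrite ?orbT ?orbF.
Qed.

(** The indices of a door d that can be dispensed with: the minima of d.1 in the
    remaining orders still exhaust d.1. Each of them yields one room. *)
Definition exits d : {set I} :=
  [set k in d.2 | [forall x in d.1, exists l in d.2 :\ k, below l x d.1]].

(** The points that prevent (d.1, d.2 :\ k) from being dominant. *)
Definition undominated d k : {set T} :=
  [set y | ~~ [exists l in d.2 :\ k, below l y d.1]].

(** The room behind exit k: k is dropped if this leaves the cell dominant,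
    otherwise the k-largest obstruction is added. *)
Definition pivot d k : {set T} * {set I} :=
  if [pick y in undominated d k |
        [forall z in undominated d k, rk k z <= rk k y]]
    is Some y then (y |: d.1, d.2) else (d.1, d.2 :\ k).

Lemma pivotP d k : door d -> k \in exits d ->
  (undominated d k = set0 /\ pivot d k = (d.1, d.2 :\ k)) \/
  exists y, [/\ y \in undominated d k, y \notin d.1,
    {in undominated d k, forall z, rk k z <= rk k y} &
    pivot d k = (y |: d.1, d.2)].
Proof.
move=> dd; rewrite inE => /andP[kD /forall_inP kx]; rewrite /pivot.
case: pickP => [y /andP[yM /forall_inP ymax]|nM].
  right; exists y; split=> //; apply: contraTN yM => /kx H.
  by rewrite inE negbK.
left; split=> //; case: (set_0Vmem (undominated d k)) => // -[y0 y0M].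
have [y yM ymax] := arg_maxnP (rk k) y0M.
by have /negP[] := nM y; rewrite [_ \in _]yM; apply/forall_inP.
Qed.

Lemma pivot_room d k : door d -> k \in exits d ->
  room (pivot d k) && adjacent d (pivot d k).
Proof.
move=> dd kK; have [[M0 ->]|[y [yM ys ymax ->]]] := pivotP dd kK.
  have kD : k \in d.2 by move: kK; rewrite inE => /andP[].
  case/andP: dd => _ /eqP cd; rewrite /room /adjacent /= !subxx /=.
  rewrite -eqSS -cd (cardsD1 k d.2) kD eqxx andbT subD1set andbT.
  apply/forallP => z; apply: contraT => nz.
  have : z \in undominated d k by rewrite inE; apply: nz.
  by rewrite M0 inE.
case/andP: dd => /dominantP domd /eqP cd.
rewrite /room /adjacent /= subsetUr subxx !andbT cardsU1 ys cd eqxx andbT.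
apply/dominantP => z /=.
have [zM|] := boolP (z \in undominated d k).
  have [l lD lz] := domd z; have el : l = k.
    apply: contraTeq zM => lk; rewrite inE negbK; apply/exists_inP.
    by exists l => //; rewrite !inE lk.
  rewrite {}el in lD lz; exists k => //; apply/belowP => x /setU1P[->|xs].
    exact: ymax.
  by move/belowP: lz; apply.
rewrite inE negbK => /exists_inP[l lD lz]; exists l.
  by move: lD => /setD1P[].
apply/belowP => x /setU1P[->|]; last exact/belowP.
move: yM; rewrite inE negb_exists_in => /forall_inP/(_ _ lD).
rewrite negb_forall_in => /exists_inP[w ws]; rewrite -ltnNge => /ltnW.
by apply: leq_trans; move/belowP: lz; apply.
Qed.

Lemma pivot_inj d : door d -> {in exits d &, injective (pivot d)}.
Proof.
move=> dd k k' kK k'K.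
have kD : k \in d.2 by move: kK; rewrite inE => /andP[].
have k'D : k' \in d.2 by move: k'K; rewrite inE => /andP[].
have [[_ ->]|[y [yM ys _ ->]]] := pivotP dd kK;
  have [[_ ->]|[y' [y'M y's _ ->]]] := pivotP dd k'K => -[].
- by move=> /setP/(_ k); rewrite !inE eqxx kD !andbT => /esym/negbFE/eqP.
- by move=> /setP/(_ y'); rewrite !inE eqxx (negbTE y's).
- by move=> /setP/(_ y); rewrite !inE eqxx (negbTE ys).
move=> /setP/(_ y); rewrite !inE eqxx (negbTE ys) !orbF => /esym/eqP eyy'.
rewrite -{y'}eyy' in y'M y's.
apply: contraTeq isT => kk'.
case/andP: dd => /dominantP/(_ y)[l lD ly] _.
have [lk|lk] := eqVneq l k.
  move: y'M; rewrite inE => /negP[]; apply/exists_inP; exists l => //.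
  by rewrite !inE lD lk kk'.
move: yM; rewrite inE => /negP[]; apply/exists_inP; exists l => //.
by rewrite !inE lD lk.
Qed.

(** Conversely every room adjacent to d lies behind one of its exits. *)
Lemma room_pivot d r : door d -> room r -> adjacent d r ->
  exists2 k, k \in exits d & r = pivot d k.
Proof.
move=> dd /andP[domr /eqP cr]; have /andP[domd /eqP cd] := dd.
case/(adjacentP cd cr) => [[y ys]|[k kD]] er; last first.
  rewrite {}er in domr cr *; have kK : k \in exits d.
    rewrite inE kD; apply/forall_inP => x xs.
    by move/forallP: domr => /(_ x).
  exists k => //; have [[_ ->]//|[y [yM _ _ _]]] := pivotP dd kK.
  by move: yM; rewrite inE; move/forallP: domr => /(_ y) /= ->.
rewrite {}er in domr cr *; rewrite /= in cr.
have domy := dominantP _ domr; rewrite /= in domy.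
(* The map sending an index to the minimum of y |: d.1 is a bijection, and the
   index sent to y is the exit. *)
pose g l := [arg min_(x < y in y |: d.1) rk l x].
have gP l : g l \in y |: d.1 /\ below l (g l) (y |: d.1).
  rewrite /g; case: arg_minnP => [|x xs xmin]; first exact: setU11.
  by split=> //; apply/belowP.
have gU l x : x \in y |: d.1 -> below l x (y |: d.1) -> g l = x.
  by move=> xs lx; have [gs lg] := gP l; apply: below_inj lg lx.
have g_onto : g @: d.2 = y |: d.1.
  apply/setP => x; apply/imsetP/idP => [[l _ ->]|xs]; first by have [] := gP l.
  by have [l lD lx] := domy x; exists l => //; rewrite (gU l x).
have g_inj : {in d.2 &, injective g}.
  by apply/imset_injP; rewrite g_onto cr.
have /imsetP[k kD yk] : y \in g @: d.2 by rewrite g_onto setU11.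
have kK : k \in exits d.
  rewrite inE kD; apply/forall_inP => x xs.
  have [l lD lx] := domy x; apply/exists_inP; exists l.
    rewrite !inE lD andbT; apply: contraNneq ys => lk.
    by rewrite yk -lk (gU l x) // setU1r.
  by apply: belowS lx; apply: subsetUr.
have yM : y \in undominated d k.
  rewrite inE negb_exists_in; apply/forall_inP => l /setD1P[lk lD].
  apply: contra lk => ly; apply/eqP/g_inj => //; rewrite -yk; apply: gU.
    exact: setU11.
  by apply/belowP => x /setU1P[->//|]; apply/belowP.
exists k => //; have [[M0 _]|[z [zM zs zmax ->]]] := pivotP dd kK.
  by rewrite M0 inE in yM.
have [l lD lz] := domy z; suff -> : y = z by [].
have lk : l = k.
  apply: contraTeq zM => lk; rewrite inE negbK; apply/exists_inP.
  by exists l; [rewrite !inE lk|apply: belowS lz; apply: subsetUr].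
apply: (@rk_inj k); apply/eqP; rewrite eqn_leq zmax //=.
by move/belowP: lz; rewrite lk; apply; apply: setU11.
Qed.

Lemma card_rooms d : door d -> #|[set r | room r && adjacent d r]| = #|exits d|.
Proof.
move=> dd; rewrite -(card_in_imset (pivot_inj dd)); apply: eq_card => r.
rewrite inE; apply/idP/imsetP => [/andP[rr adr]|[k kK ->]].
  exact: room_pivot.
exact: pivot_room.
Qed.


(** A door has two exits, given by the unique coincidence among the minima of
    d.1 in the #|d.1| + 1 orders of d.2, except that a door without points has
    one. *)
Lemma card_exits d : door d -> odd #|exits d| = (d.1 == set0).
Proof.
move=> /andP[/dominantP domd /eqP cd].
have [s0|[x0 x0s]] := set_0Vmem d.1.
  have : #|d.2| == 1 by rewrite cd s0 cards0.
  case/cards1P => k dk; rewrite s0 eqxx.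
  suff -> : exits d = [set k] by rewrite cards1.
  apply/setP => l; rewrite !inE dk !inE; case: eqP => //= _.
  by apply/forall_inP => x; rewrite s0 inE.
pose g l := [arg min_(x < x0 in d.1) rk l x].
have gP l : g l \in d.1 /\ below l (g l) d.1.
  rewrite /g; case: arg_minnP => [//|x xs xmin].
  by split=> //; apply/belowP.
have gU l x : x \in d.1 -> below l x d.1 -> g l = x.
  by move=> xs lx; have [gs lg] := gP l; apply: below_inj lg lx.
have g_onto : g @: d.2 = d.1.
  apply/setP => x; apply/imsetP/idP => [[l _ ->]|xs]; first by have [] := gP l.
  by have [l lD lx] := domd x; exists l => //; rewrite (gU l x).
have -> : (d.1 == set0) = odd 2 by apply/negbTE/set0Pn; exists x0.
congr odd; rewrite -g_onto in cd; rewrite -(card_collision cd).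
apply: eq_card => k; rewrite !inE; congr andb; rewrite g_onto eqEsubset.
have -> : g @: (d.2 :\ k) \subset d.1.
  by apply/subsetP => _ /imsetP[l _ ->]; have [] := gP l.
apply/forall_inP/subsetP => [H x /[dup] xs /H /exists_inP[l lD lx]|H x /H].
  by apply/imsetP; exists l => //; rewrite (gU l x).
by case/imsetP => l lD ->; apply/exists_inP; exists l => //; have [] := gP l.
Qed.

Section Coloring.
Variables (c : T -> I) (i : I).

(** The colors of the points of d are the indices of d other than i. *)
Definition almost_colorful d := c @: d.1 == d.2 :\ i.

Lemma card_almost_colorful_doors r : room r ->
  #|[set d | door d && almost_colorful d && adjacent d r]| =
  #|[set x in r.1 | c @: (r.1 :\ x) == r.2 :\ i]| +
  #|[set j | (j \notin r.2) && (c @: r.1 == (j |: r.2) :\ i)]|.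
Proof.
case: r => s C rr; have /andP[/= domr /eqP /= cr] := rr.
set X := [set x in _ | _]; set J := [set j | _].
pose fx x : {set T} * {set I} := (s :\ x, C).
pose fj j : {set T} * {set I} := (s, j |: C).
have fxI : {in X &, injective fx}.
  move=> x y /setIdP[xs _] /setIdP[ys _] [] /setP/(_ x).
  by rewrite !inE eqxx xs !andbT => /esym/negbFE/eqP.
have fjI : {in J &, injective fj}.
  move=> j l; rewrite !inE => /andP[jC _] /andP[lC _] [] /setP/(_ j).
  by rewrite !inE eqxx (negbTE jC) !orbF => /esym/eqP.
rewrite -(card_in_imset fxI) -(card_in_imset fjI) -cardsUI.
rewrite [X in _ + X]eq_card0 ?addn0; last first.
  move=> d; rewrite !inE; apply/negP => /andP[/imsetP[x xX ->] /imsetP[j _]].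
  by case=> /setP/(_ x); rewrite !inE eqxx; move: xX => /setIdP[-> _].
apply: eq_card => -[t D]; rewrite inE /almost_colorful /=; apply/idP/setUP.
  case/andP => /andP[dd tD] ad; have /andP[_ /eqP cd] := dd.
  case/(adjacentP (r := (s, C)) cd cr): ad => -[] /= z zt [es eC].
    have et : t = s :\ z by rewrite es setU1K.
    left; apply/imsetP; exists z; rewrite /fx -?et ?eC //.
    by rewrite !inE -et es setU11 eC tD.
  have eD : D = z |: C by rewrite eC setD1K.
  right; apply/imsetP; exists z; rewrite /fj -?eD ?es //.
  by rewrite !inE -eD es eC tD !inE eqxx.
case=> /imsetP[z zX [-> ->]]; move: zX; rewrite !inE => /andP[zs ->];
  rewrite andbT.
  have ad : adjacent (s :\ z, C) (s, C) by rewrite /adjacent /= subD1set subxx.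
  rewrite ad /door (dominant_adjacent ad) //= -cr.
  by rewrite (cardsD1 z s) zs andbT add1n.
have ad : adjacent (s, z |: C) (s, C) by rewrite /adjacent /= subsetUr subxx.
by rewrite ad /door (dominant_adjacent ad) //= cr cardsU1 zs andbT add1n.
Qed.

(** A room that is not colorful has either no almost colorful door or two: when
    its colors are C minus i, they come from removing either point of the pair
    of equal color; when they are C minus i and a foreign color j, from
    removing the point of color j or adding the index j. *)
Lemma even_almost_colorful_doors r : room r -> c @: r.1 != r.2 ->
  ~~ odd #|[set d | door d && almost_colorful d && adjacent d r]|.
Proof.
move=> rr; rewrite card_almost_colorful_doors //.
case: r rr => s C /andP[_ /eqP/= cr] nc.
set X := [set x in _ | _]; set J := [set j | _].
have imD1 x : x \in s -> c @: s = c x |: c @: (s :\ x).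
  by move=> xs; rewrite -imsetU1 setD1K.
have [iC|iC] := boolP (i \in C); last first.
  have -> : J = set0.
    apply/setP => j; rewrite !inE; apply/negP => /andP[jC /eqP cs].
    have [ej|ji] := eqVneq j i.
      by move/negP: nc; apply; rewrite cs ej setU1K.
    have : #|c @: s| <= #|s| by apply: leq_imset_card.
    have -> : c @: s = j |: C.
      rewrite cs; apply/setDidPl; rewrite disjoint_sym disjoints1.
      by rewrite !inE negb_or iC andbT eq_sym.
    by rewrite cardsU1 jC cr ltnn.
  have -> : X = set0.
    apply/setP => x; rewrite !inE; apply/negP => /andP[xs /eqP cs].
    have : #|c @: (s :\ x)| <= #|s :\ x| by apply: leq_imset_card.
    have -> : c @: (s :\ x) = C.
      by rewrite cs; apply/setDidPl; rewrite disjoint_sym disjoints1.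
    by rewrite -cr (cardsD1 x s) xs ltnn.
  by rewrite !cards0.
have [J0|[j jJ]] := set_0Vmem J.
  rewrite J0 cards0 addn0; have [->|[x xX]] := set_0Vmem X.
    by rewrite cards0.
  have [xs /eqP cx] := setIdP xX; have := imD1 x xs; rewrite cx => es.
  have ci : c x != i.
    by apply: contraNneq nc => ci; rewrite es ci setD1K.
  have cC : c x \in C.
    apply: contraT => cC; suff : c x \in J by rewrite J0 inE.
    rewrite !inE cC es /=; apply/eqP/setP => l; rewrite !inE.
    by have [->|] := eqVneq l (c x); rewrite //= ci.
  have {}es : c @: s = C :\ i.
    by rewrite es; apply/setUidPr; rewrite sub1set !inE ci.
  have Ec : #|s| = #|c @: s|.+1 by rewrite cr es (cardsD1 i C) iC.
  by rewrite /X -es card_collision.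
have [jC /eqP es] : j \notin C /\ c @: s == (j |: C) :\ i.
  by move: jJ; rewrite inE => /andP[].
have ji : j != i by apply: contraNneq jC => ->.
have -> : J = [set j].
  apply/setP => l; rewrite [RHS]inE; apply/idP/eqP => [|->//].
  rewrite inE => /andP[lC /eqP]; rewrite es => /setP/(_ l).
  rewrite !inE eqxx /= (negbTE lC) orbF andbT => El.
  have li : l != i by apply: contraNneq lC => ->.
  by move: El; rewrite li /= => /eqP.
have /imset_injP cI : #|c @: s| == #|s|.
  rewrite es cr; have := cardsD1 i (j |: C); rewrite !inE iC orbT /=.
  by rewrite cardsU1 jC add1n add1n => -[->].
have /imsetP[x xs jx] : j \in c @: s by rewrite es !inE eqxx ji.
suff -> : X = [set x] by rewrite !cards1.
apply/setP => y; rewrite [RHS]inE; apply/setIdP/eqP => [[ys /eqP cy]|->].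
  apply/eqP; apply: contraT => yx.
  have : j \in C :\ i.
    by rewrite -cy jx; apply/imset_f; rewrite !inE xs eq_sym yx.
  by rewrite !inE (negbTE jC) andbF.
split=> //; apply/eqP/setP => l; have := imD1 x xs; rewrite es -jx.
have jn : j \notin c @: (s :\ x).
  apply/imsetP => -[z /setD1P[zx zs] jz].
  by case/eqP: zx; apply: cI; rewrite // -jz.
move=> /setP/(_ l); rewrite !inE.
have [->|lj] := eqVneq l j; rewrite ?(negbTE jn) ?(negbTE jC) ?andbF //=.
Qed.

End Coloring.

(** Counting the incidences between rooms and almost colorful doors modulo 2:
    the only almost colorful door with an odd number of rooms is the one with no
    point and the single index i, so some room has an odd number of almost
    colorful doors. *)
Theorem colorful_room (c : T -> I) (t0 : T) (i : I) :
  exists2 r, room r & c @: r.1 = r.2.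
Proof.
have [|/existsPn nr] := boolP [exists r, room r && (c @: r.1 == r.2)].
  by case/existsP => r /andP[rr /eqP]; exists r.
pose d0 : {set T} * {set I} := (set0, [set i]).
have dd0 : door d0.
  rewrite /door /= cards1 cards0 eqxx andbT; apply/dominantP => y.
  by exists i; rewrite ?set11 //; apply/belowP => x; rewrite inE.
have td0 : almost_colorful c i d0 by rewrite /almost_colorful imset0 setDv.
have : \sum_(d | door d && almost_colorful c i d)
         #|[set r | room r && adjacent d r]| =
       \sum_(r | room r)
         #|[set d | door d && almost_colorful c i d && adjacent d r]|.
  under eq_bigr do rewrite cardsE -sum1_card.
  rewrite (exchange_big_dep room) /=; last by move=> d r _ /andP[].
  apply: eq_bigr => r rr; rewrite cardsE -sum1_card.
  by apply: eq_bigl => d; rewrite !unfold_in rr.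
move=> /(congr1 odd); rewrite !(big_morph odd oddD (erefl _)).
rewrite [RHS]big1; last first.
  move=> r rr; apply/negbTE/even_almost_colorful_doors => //.
  by have := nr r; rewrite rr.
rewrite (bigD1 d0) ?dd0 //= card_rooms // card_exits // eqxx.
rewrite big1 // => d /andP[/andP[dd /eqP td] dd0'].
rewrite card_rooms // card_exits //; apply: contraNF dd0' => /eqP ds.
have /andP[_ /eqP cd] := dd; case: d => s D /= in ds cd td {dd} *.
rewrite {}ds in cd td *; rewrite imset0 in td.
have : #|D| == 1 by rewrite cd cards0.
case/cards1P=> k Dk; rewrite /d0; move: td; rewrite Dk => /setP/(_ k).
by rewrite !inE eqxx andbT => /esym/negbFE/eqP ->.
Qed.

End DominantCells.

(** * Colorings of the simplex grid *)

Section Grid.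
Variables (n k : nat).

(** The points with integer coordinates of the dilated simplex of coordinate sum
    k. *)
Definition grid := {x : {ffun 'I_n.+1 -> 'I_k.+1} | \sum_i x i == k}.

Definition coord_of (x : grid) (i : 'I_n.+1) : nat := val x i.

Lemma sum_coord_of x : \sum_i coord_of x i = k.
Proof. exact/eqP/(valP x). Qed.

Lemma grid_above (b : 'I_n.+1 -> nat) : \sum_i b i <= k ->
  exists y : grid, forall i, b i <= coord_of y i.
Proof.
move=> bk; pose g (i : 'I_n.+1) := b i + (i == ord0) * (k - \sum_j b j).
have sg : \sum_i g i = k.
  rewrite big_split -big_distrl /= [X in _ + X * _](bigD1 ord0) //=.
  rewrite [X in 1 + X]big1 => [|i /negbTE->//].
  by rewrite addn0 mul1n subnKC.
have gk i : g i < k.+1 by rewrite ltnS -sg (bigD1 i) //= leq_addr.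
pose y : {ffun 'I_n.+1 -> 'I_k.+1} := [ffun i => Ordinal (gk i)].
have yP : \sum_i y i == k.
  by rewrite -[X in _ == X]sg; apply/eqP/eq_bigr => i _; rewrite ffunE.
by exists (Sub y yP) => i; rewrite /coord_of SubK ffunE leq_addr.
Qed.

(** The order of the grid points by their i-th coordinate, ties being broken by
    an enumeration that does not depend on i. *)
Definition coord_rank (i : 'I_n.+1) (x : grid) : nat :=
  coord_of x i * #|{: grid}| + enum_rank x.

Lemma coord_rank_inj i : injective (coord_rank i).
Proof.
move=> x y /(congr1 (modn^~ #|{: grid}|)); rewrite !modnMDl !modn_small //.
by move=> /ord_inj/enum_rank_inj.
Qed.

Lemma coord_rank_lt i x y : coord_of x i < coord_of y i ->
  coord_rank i x < coord_rank i y.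
Proof.
move=> xy; rewrite /coord_rank.
have := leq_mul xy (leqnn #|{: grid}|); rewrite mulSn => H.
apply: leq_trans (leq_trans H (leq_addr _ _)).
by rewrite addnC ltn_add2r ltn_ord.
Qed.

(** The coordinates of the points of a colorful room of the grid differ by at
    most n: their lower bounds mu (0 for the indices outside the room) add up to
    at least k - n, since otherwise some grid point would exceed the bounds
    strictly at all the indices of the room, against dominance. *)
Theorem grid_coloring (c : grid -> 'I_n.+1) :
  exists C : {set 'I_n.+1}, exists z : 'I_n.+1 -> grid,
  [/\ C != set0,
      {in C, forall i, c (z i) = i},
      {in C &, forall i j l, coord_of (z i) l <= coord_of (z j) l + n}
    & {in C, forall i l, l \notin C -> coord_of (z i) l <= n}].
Proof.
have [t0 _] : exists y : grid, forall i, 0 <= coord_of y i.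
  by apply: (grid_above (b := fun=> 0)); rewrite big1.
have [[s C] /andP[/dominantP /= dom _] /= cs] :=
  colorful_room coord_rank_inj c t0 ord0.
have [i0 i0C _] := dom t0.
have [x0 x0s _] : exists2 x, x \in s & i0 = c x by apply/imsetP; rewrite cs.
pose z i := odflt x0 [pick x in s | c x == i].
have zP : {in C, forall i, z i \in s /\ c (z i) = i}.
  move=> i; rewrite -cs => /imsetP[x xs ix]; rewrite /z.
  case: pickP => [y /andP[ys /eqP]//|/(_ x)]; by rewrite xs ix eqxx.
pose low l := [arg min_(x < x0 in s) coord_of x l].
pose mu l := if l \in C then coord_of (low l) l else 0.
have lowP l :
    low l \in s /\ {in s, forall x, coord_of (low l) l <= coord_of x l}.
  by rewrite /low; case: arg_minnP.
have mu_low x l : x \in s -> mu l <= coord_of x l.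
  by move=> xs; rewrite /mu; case: ifP => // _; apply: (lowP l).2.
have mu_sum : k <= \sum_l mu l + n.
  rewrite leqNgt; apply/negP => lek.
  have : \sum_l (mu l + (l \in C)) <= k.
    rewrite big_split /=; apply: leq_trans lek.
    rewrite -addnS leq_add2l -[X in _ <= X]card_ord -sum1_card.
    by apply: leq_sum => l _; apply: leq_b1.
  case/grid_above => y yP; have [l lC /belowP/(_ _ (lowP l).1)] := dom y.
  rewrite leqNgt => /negP[]; apply: coord_rank_lt.
  by have := yP l; rewrite /mu lC addn1.
have near x l : x \in s -> coord_of x l <= mu l + n.
  move=> xs; move: mu_sum; rewrite -{1}(sum_coord_of x).
  rewrite (bigD1 l) //= [X in _ <= X + _ -> _](bigD1 l) //= addnAC => H.
  rewrite -(leq_add2r (\sum_(i < n.+1 | i != l) mu i)).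
  apply: leq_trans H; rewrite leq_add2l.
  by apply: leq_sum => i _; apply: mu_low.
exists C, z; split.
- by apply/set0Pn; exists i0.
- by move=> i /zP[].
- move=> i j /zP[is_ _] /zP[js _] l; apply: leq_trans (near _ l is_) _.
  by rewrite leq_add2r mu_low.
- move=> i /zP[is_ _] l lC; have := near _ l is_.
  by rewrite /mu (negbTE lC).
Qed.

End Grid.

From mathcomp Require Import all_classical all_reals all_analysis.
From mathcomp Require Import ring lra.
Import Order.TTheory GRing.Theory Num.Theory.
Import numFieldNormedType.Exports.
Local Open Scope classical_set_scope.
Local Open Scope ring_scope.

(** * Brouwer's theorem on the standard simplex *)

Section Brouwer.
Variable R : realType.

Lemma le_mx_norm m n (M : 'M[R]_(m, n)) i j : `|M i j| <= `|M|.
Proof.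
rewrite [leRHS]mx_normrE.
by rewrite (le_trans _ (le_bigmax _ _ (i, j))).
Qed.

Lemma mx_norm_le m n (M : 'M[R]_(m, n)) b : 0 <= b ->
  (forall i j, `|M i j| <= b) -> `|M| <= b.
Proof.
move=> b0 Mb; rewrite [leLHS]mx_normrE.
by apply: bigmax_le => // -[i j] _; apply: Mb.
Qed.

Lemma continuous_sum (T : topologicalType) (I : finType) (F : I -> T -> R) :
  (forall i, continuous (F i)) -> continuous (fun x => \sum_i F i x).
Proof.
by move=> Fc x; apply: cvg_big => [|i _]; [exact: add_continuous|exact: Fc].
Qed.

(** The standard simplex of dimension n, in barycentric coordinates. *)
Definition simplex n : set 'rV[R]_n.+1 :=
  [set w | (forall i, 0 <= w 0 i) /\ \sum_i w 0 i = 1].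

Lemma simplex_compact n : compact (@simplex n).
Proof.
apply: bounded_closed_compact.
  exists 1; split; first by rewrite num_real.
  move=> b b1 w [w0 w1]; apply: mx_norm_le => [|i j].
    by rewrite (le_trans _ (ltW b1)).
  rewrite ord1 ger0_norm // (le_trans _ (ltW b1)) // -w1 (bigD1 j) //= lerDl.
  by apply: sumr_ge0.
rewrite (_ : simplex (n := n) =
  (\bigcap_i [set w | 0 <= w 0 i]) `&` [set w | \sum_i w 0 i = 1]).
  apply: closedI.
    apply: closed_bigI => i _.
    apply: (@preimage_closed _ _ (fun w : 'rV[R]_n.+1 => w 0 i) [set r | 0 <= r]).
      by move=> w _; apply: coord_continuous.
    exact: closed_ge.
  apply: (@preimage_closed _ _ (fun w : 'rV[R]_n.+1 => \sum_i w 0 i) [set 1]).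
    by move=> w _; apply: continuous_sum => i; apply: coord_continuous.
  exact: closed_eq.
apply/seteqP; split=> w [w0 w1]; split=> // i; first by move=> _; apply: w0.
exact: w0.
Qed.

(** A grid point x is colored by an index i with x_i <= f(x)_i, which exists
    because both sides sum to 1. Near the points of a colorful room the
    inequality then holds for every index, up to the mesh: for an index outside
    the room the coordinate itself is small. *)
Lemma approximate_fixpoint n (f : 'rV[R]_n.+1 -> 'rV[R]_n.+1) (k : nat) :
  (forall w, simplex w -> simplex (f w)) ->
  exists2 w, simplex w & forall i, exists w', [/\ simplex w',
    `|w' - w| <= n%:R / k.+1%:R & w' 0 i <= f w' 0 i + n%:R / k.+1%:R].
Proof.
move=> fS; pose e : R := k.+1%:R^-1.
have e_gt0 : 0 < e by rewrite invr_gt0 ltr0n.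
pose pt (x : grid n k.+1) : 'rV[R]_n.+1 := \row_i ((coord_of x i)%:R * e).
have ptS x : simplex (pt x).
  split=> [i|]; first by rewrite mxE mulr_ge0 // ltW.
  under eq_bigr do rewrite mxE.
  by rewrite -mulr_suml -natr_sum sum_coord_of mulfV // pnatr_eq0.
have /choice[c cP] : forall x, exists i, pt x 0 i <= f (pt x) 0 i.
  move=> x; apply: contrapT => /forallNP H.
  have : \sum_i f (pt x) 0 i < \sum_i pt x 0 i.
    apply: ltr_sum => [|i _].
      by apply/hasP; exists ord0; rewrite ?mem_index_enum.
    by rewrite ltNge; apply/negP/H.
  by rewrite (ptS x).2 (fS _ (ptS x)).2 ltxx.
have [C [z [/set0Pn[i0 i0C] cz near far]]] := grid_coloring c.
have near_pt i j : i \in C -> j \in C -> `|pt (z i) - pt (z j)| <= n%:R * e.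
  move=> iC jC; apply: mx_norm_le => [|? l]; first by rewrite mulr_ge0 // ltW.
  rewrite !mxE -mulrBl normrM (gtr0_norm e_gt0) ler_pM2r //.
  by rewrite ler_distl lerBlDr -!natrD !ler_nat !near.
exists (pt (z i0)) => // i; have [iC|iC] := boolP (i \in C).
  exists (pt (z i)); split=> //; first exact: near_pt.
  by rewrite -[leLHS]addr0 lerD //; have := cP (z i); rewrite cz.
exists (pt (z i0)); split=> //; first by rewrite subrr normr0 mulr_ge0 // ltW.
rewrite -[leLHS]add0r lerD //; first exact: (fS _ (ptS _)).1.
by rewrite mxE ler_pM2r // ler_nat far.
Qed.

(** A cluster point p of approximate fixed points satisfies p_i <= f(p)_i for
    all i, hence p = f(p) since both have coordinate sum 1. *)
Theorem brouwer_simplex n (f : 'rV[R]_n.+1 -> 'rV[R]_n.+1) :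
  {within @simplex n, continuous f} ->
  (forall w, simplex w -> simplex (f w)) ->
  exists2 w, simplex w & f w = w.
Proof.
move=> fc fS.
have /choice[w wP] : forall k : nat, exists w, simplex w /\
    forall i, exists w', [/\ simplex w', `|w' - w| <= n%:R / k.+1%:R
                          & w' 0 i <= f w' 0 i + n%:R / k.+1%:R].
  by move=> k; have [w wS wi] := approximate_fixpoint k fS; exists w.
have [|p [pS p_cluster]] := @simplex_compact n (w @ \oo) _.
  by exists 0%N => // k _; have [] := wP k.
exists p => //; have le_fp i : p 0 i <= f p 0 i.
  apply/ler_addgt0Pr => _/posnumP[e].
  have e4 : 0 < e%:num / 4 by rewrite divr_gt0.
  have : \forall q \near p, simplex q -> `|f p - f q| < e%:num / 4.
    have := fc p; rewrite /continuous_at /= => /cvgr_dist_lt/(_ _ e4).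
    by rewrite {1}/nbhs /= -nbhs_subspace_in // near_withinE.
  case/nbhs_ballP => d /= d_gt0 dP.
  pose d' := Num.min (d / 2) (e%:num / 4).
  have d'_gt0 : 0 < d' by rewrite lt_min e4 divr_gt0.
  have small : \forall k \near \oo, n%:R / k.+1%:R < d'.
    have /cvgr0_norm_lt/(_ _ d'_gt0) :
        n%:R * harmonic k @[k --> \oo] --> (0 : R).
      by rewrite -[0](mulr0 n%:R); apply: cvgM; [exact: cvg_cst|exact: cvg_harmonic].
    by apply: filterS => k; apply: le_lt_trans; apply: ler_norm.
  have [q [[k kd' <-]]] :
      ((w @` [set k | n%:R / k.+1%:R < d']) `&` ball p d') !=set0.
    apply: p_cluster; last exact: nbhsx_ballx.
    by apply: filterS small => k kd; exists k.
  rewrite -ball_normE /= => pk.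
  have [_ /(_ i)[w' [w'S w'k w'i]]] := wP k.
  have pw' : `|p - w'| < d' + d'.
    rewrite -[p - w'](subrKA (w k)) (le_lt_trans (ler_normD _ _)) // ltrD //.
    by rewrite distrC (le_lt_trans w'k).
  have /dP : ball p d w'.
    rewrite -ball_normE /= (lt_le_trans pw') // [leRHS]splitr lerD //.
      by rewrite ge_min lexx.
    by rewrite ge_min lexx.
  move=> /(_ w'S) fpw'.
  have d'e : d' <= e%:num / 4 by rewrite ge_min lexx orbT.
  have h1 := le_lt_trans (le_mx_norm (f p - f w') 0 i) fpw'.
  have h2 := le_lt_trans (le_mx_norm (p - w') 0 i) pw'.
  move: h1 h2; rewrite !mxE ltr_distl ltr_distl => /andP[h1 _] /andP[_ h2].
  have {}kd' : n%:R / k.+1%:R < d' := kd'.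
  move: d'e h1 h2 w'i kd'.
  by move: (e%:num) (n%:R / k.+1%:R) (d') => e0 t b *; lra.
apply/rowP => i; apply/eqP; rewrite -subr_eq0.
have : \sum_i (f p 0 i - p 0 i) = 0 by rewrite sumrB pS.2 (fS _ pS).2 subrr.
by move=> /psumr_eq0P -> // j _; rewrite subr_ge0.
Qed.

End Brouwer.

(** * Euclidean norm and projection *)

Section Euclidean.
Variable R : realType.

Lemma dotE n (u v : 'cV[R]_n) : dot u v = \sum_i u i 0 * v i 0.
Proof. by rewrite /dot mxE; apply: eq_bigr => i _; rewrite mxE. Qed.

Lemma dotC n (u v : 'cV[R]_n) : dot u v = dot v u.
Proof. by rewrite !dotE; apply: eq_bigr => i _; rewrite mulrC. Qed.

Lemma dotDl n (u v w : 'cV[R]_n) : dot (u + v) w = dot u w + dot v w.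
Proof. by rewrite /dot linearD mulmxDl mxE. Qed.

Lemma dotZl n a (u w : 'cV[R]_n) : dot (a *: u) w = a * dot u w.
Proof. by rewrite /dot linearZ -scalemxAl mxE. Qed.

Lemma dotNl n (u w : 'cV[R]_n) : dot (- u) w = - dot u w.
Proof. by rewrite -scaleN1r dotZl mulN1r. Qed.

Lemma dotDr n (u v w : 'cV[R]_n) : dot w (u + v) = dot w u + dot w v.
Proof. by rewrite dotC dotDl !(dotC w). Qed.

Lemma dotZr n a (u w : 'cV[R]_n) : dot w (a *: u) = a * dot w u.
Proof. by rewrite dotC dotZl dotC. Qed.

Lemma dotNr n (u w : 'cV[R]_n) : dot w (- u) = - dot w u.
Proof. by rewrite dotC dotNl dotC. Qed.

Lemma norm2_ge0 n (v : 'cV[R]_n) : 0 <= norm2 v.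
Proof. exact: sqrtr_ge0. Qed.
Hint Resolve norm2_ge0 : core.

Lemma sqr_norm2 n (v : 'cV[R]_n) : norm2 v ^+ 2 = \sum_i v i 0 ^+ 2.
Proof. by rewrite sqr_sqrtr // sumr_ge0 // => i _; rewrite sqr_ge0. Qed.

Lemma norm2_dot n (v : 'cV[R]_n) : norm2 v ^+ 2 = dot v v.
Proof. by rewrite sqr_norm2 dotE; apply: eq_bigr => i _; rewrite expr2. Qed.

Lemma norm2_eq0 n (v : 'cV[R]_n) : norm2 v <= 0 -> v = 0.
Proof.
move=> v0; have {v0}: norm2 v ^+ 2 = 0.
  by rewrite (_ : norm2 v = 0) ?expr0n //; apply/eqP; rewrite eq_le v0 /=.
rewrite sqr_norm2 => /psumr_eq0P v0; apply/colP => i; rewrite mxE.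
by apply/eqP; rewrite -sqrf_eq0 v0 // => j _; rewrite sqr_ge0.
Qed.

Lemma norm2_0 n : norm2 (0 : 'cV[R]_n) = 0.
Proof.
by rewrite /norm2 big1 ?sqrtr0 // => i _; rewrite mxE expr0n.
Qed.

Lemma norm2N n (v : 'cV[R]_n) : norm2 (- v) = norm2 v.
Proof.
by rewrite /norm2; congr Num.sqrt; apply: eq_bigr => i _; rewrite mxE sqrrN.
Qed.

Lemma norm2B n (u v : 'cV[R]_n) : norm2 (u - v) = norm2 (v - u).
Proof. by rewrite -norm2N opprB. Qed.

Lemma norm2Z n a (v : 'cV[R]_n) : norm2 (a *: v) = `|a| * norm2 v.
Proof.
rewrite /norm2 -sqrtr_sqr -sqrtrM ?sqr_ge0 // mulr_sumr; congr Num.sqrt.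
by apply: eq_bigr => i _; rewrite mxE exprMn.
Qed.

Lemma sqr_norm2D n (u v : 'cV[R]_n) :
  norm2 (u + v) ^+ 2 = norm2 u ^+ 2 + 2 * dot u v + norm2 v ^+ 2.
Proof. rewrite !norm2_dot !dotDl !dotDr (dotC v u); ring. Qed.

Lemma cauchy_schwarz n (u v : 'cV[R]_n) : dot u v <= norm2 u * norm2 v.
Proof.
have [u0|u_gt0] := leP (norm2 u) 0.
  rewrite (norm2_eq0 u0) norm2_0 mul0r dotE big1 // => i _.
  by rewrite mxE mul0r.
have [v0|v_gt0] := leP (norm2 v) 0.
  rewrite (norm2_eq0 v0) norm2_0 mulr0 dotE big1 // => i _.
  by rewrite mxE mulr0.
have := sqr_ge0 (norm2 (norm2 v *: u - norm2 u *: v)).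
rewrite sqr_norm2D norm2N !norm2Z !ger0_norm // dotNr dotZl dotZr.
rewrite (_ : _ + _ = 2 * (norm2 v * norm2 u) * (norm2 u * norm2 v - dot u v)).
  by rewrite pmulr_rge0 ?subr_ge0 // !mulr_gt0.
ring.
Qed.

Lemma ler_norm2D n (u v : 'cV[R]_n) : norm2 (u + v) <= norm2 u + norm2 v.
Proof.
rewrite -(ler_pXn2r (n := 2)) ?nnegrE ?addr_ge0 // sqr_norm2D.
have := cauchy_schwarz u v; nra.
Qed.

Lemma le_norm_norm2 n (v : 'cV[R]_n) : `|v| <= norm2 v.
Proof.
apply: mx_norm_le => // i j; rewrite ord1.
rewrite -(ler_pXn2r (n := 2)) ?nnegrE // sqr_norm2 real_normK ?num_real //.
by rewrite (bigD1 i) //= lerDl sumr_ge0 // => k _; rewrite sqr_ge0.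
Qed.

Lemma le_norm2_norm n (v : 'cV[R]_n) : norm2 v <= Num.sqrt n%:R * `|v|.
Proof.
rewrite -(ler_pXn2r (n := 2)) ?nnegrE ?mulr_ge0 ?sqrtr_ge0 // sqr_norm2.
rewrite exprMn sqr_sqrtr ?ler0n // mulr_natl -[X in _ *+ X]card_ord -sumr_const.
apply: ler_sum => i _; rewrite -real_normK ?num_real //.
by rewrite ler_pXn2r ?nnegrE // le_mx_norm.
Qed.

Lemma norm2_lipschitz_continuous m n (Y : set 'cV[R]_m)
    (g : 'cV[R]_m -> 'cV[R]_n) (c : R) :
  (forall u v, Y u -> Y v -> norm2 (g u - g v) <= c * norm2 (u - v)) ->
  {within Y, continuous g}.
Proof.
move=> gc.
have {}gc u v : Y u -> Y v ->
    `|g u - g v| <= (`|c| * Num.sqrt m%:R + 1) * `|u - v|.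
  move=> Yu Yv; apply: (le_trans (le_norm_norm2 _)).
  apply: (le_trans (gc _ _ Yu Yv)).
  rewrite mulrDl mul1r -[leLHS]addr0 lerD // -mulrA.
  apply: le_trans (_ : `|c| * norm2 (u - v) <= _).
    by rewrite ler_wpM2r // ler_norm.
  by rewrite ler_wpM2l // le_norm2_norm.
set k := _ + 1 in gc.
have k_gt0 : 0 < k by rewrite ltr_pwDr // mulr_ge0 // sqrtr_ge0.
apply/subspace_continuousP => u Yu; apply/cvgrPdist_lt => e e_gt0.
rewrite near_withinE.
near=> v => Yv; apply: le_lt_trans (gc _ _ Yu Yv) _.
rewrite mulrC -ltr_pdivlMr //; near: v.
by apply: cvgr_dist_lt; [exact: cvg_id|rewrite divr_gt0].
Unshelve. all: by end_near. Qed.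

Lemma norm2_continuous n (z : 'cV[R]_n) :
  continuous (fun y : 'cV[R]_n => norm2 (z - y)).
Proof.
have sc : continuous (fun y : 'cV[R]_n => \sum_i (z - y) i 0 ^+ 2).
  apply: continuous_sum => i.
  have -> : (fun y : 'cV[R]_n => (z - y) i 0 ^+ 2) =
            (fun y : 'cV[R]_n => (z i 0 - y i 0) ^+ 2).
    by apply/funext => v; rewrite !mxE.
  move=> y.
  apply: (@continuous_comp _ _ _ (fun y : 'cV[R]_n => z i 0 - y i 0)
    (fun t => t ^+ 2)); last exact: exprn_continuous.
  by apply: continuousB; [exact: cst_continuous|exact: coord_continuous].
move=> y; apply: (continuous_comp (sc y)); exact: sqrt_continuous.
Qed.

Lemma convex_segment n (Y : set 'cV[R]_n) x y t : convex_set Y ->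
  Y x -> Y y -> 0 <= t <= 1 -> Y (x + t *: (y - x)).
Proof.
move=> cY Yx Yy /andP[t0 t1].
have := cY y x (@Itv01 R t t0 t1); rewrite !inE => /(_ Yy Yx).
rewrite [conv _ _ _](_ : _ = x + t *: (y - x)) //.
by rewrite /conv /= /unstable.onem scalerBr scalerBl scale1r addrCA.
Qed.

(** The variational characterization of the projection, in the direction that is
    needed: moving from p towards y by the fraction t would come closer to z. *)
Lemma euclid_proj_obtuse n (Y : set 'cV[R]_n) z p y : convex_set Y ->
  is_euclid_proj Y z p -> Y y -> dot (z - p) (y - p) <= 0.
Proof.
move=> cY [Yp pmin] Yy; rewrite leNgt; apply/negP.
set a := dot _ _ => a_gt0; pose b := norm2 (y - p) ^+ 2.
have b_ge0 : 0 <= b by rewrite sqr_ge0.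
have ab_gt0 : 0 < a + b by rewrite ltr_pwDl.
(* Small enough for the first-order decrease 2ta to beat t^2 b. *)
pose t := a / (a + b).
have t01 : 0 <= t <= 1.
  by rewrite divr_ge0 ?(ltW a_gt0) ?(ltW ab_gt0) //= ler_pdivrMr // mul1r lerDl.
have := pmin _ (convex_segment cY Yp Yy t01).
rewrite -(ler_pXn2r (n := 2)) ?nnegrE ?norm2_ge0 // opprD addrA.
rewrite (sqr_norm2D (z - p)).
rewrite norm2N norm2Z dotNr dotZr exprMn real_normK ?num_real // -/a -/b.
rewrite -addrA lerDl leNgt => /negP[].
have -> : 2 * - (t * a) + t ^+ 2 * b = - (t * (2 * a - t * b)) by ring.
rewrite oppr_lt0 mulr_gt0 ?divr_gt0 // subr_gt0.
apply: le_lt_trans (_ : a < _); last by rewrite mulr_natl mulr2n ltrDl.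
by rewrite /t mulrAC ler_pdivrMr // ler_wpM2l ?(ltW a_gt0) // lerDr ltW.
Qed.

Lemma euclid_proj_nonexpansive n (Y : set 'cV[R]_n) z z' p p' : convex_set Y ->
  is_euclid_proj Y z p -> is_euclid_proj Y z' p' ->
  norm2 (p - p') <= norm2 (z - z').
Proof.
move=> cY pz pz'.
have h := euclid_proj_obtuse cY pz pz'.1.
have h' := euclid_proj_obtuse cY pz' pz.1.
have [p0|p_gt0] := leP (norm2 (p - p')) 0; first exact: le_trans p0 _.
rewrite -(ler_pM2r p_gt0) -expr2 norm2_dot.
apply: le_trans (cauchy_schwarz _ _); rewrite -subr_ge0.
have -> : dot (z - z') (p - p') - dot (p - p') (p - p') =
    - (dot (z - p) (p' - p) + dot (z' - p') (p - p')).
  rewrite !(dotDl, dotDr, dotNl, dotNr); ring.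
by rewrite oppr_ge0 -[leRHS]addr0 lerD.
Qed.

Section CompactConvex.
Variables (n : nat) (Y : set 'cV[R]_n).
Hypotheses (Y0 : Y !=set0) (Yc : compact Y) (Ycv : convex_set Y).

Lemma euclid_projP z : is_euclid_proj Y z (euclid_proj Y z).
Proof.
suff [p pP] : exists p, is_euclid_proj Y z p by apply: (xgetI _ pP).
have [|p] := @compact_EVT_min _ R (fun y : 'cV[R]_n => norm2 (z - y)) Y Y0 Yc.
  exact/continuous_subspaceT/norm2_continuous.
by rewrite inE => Yp pmin; exists p; split=> // y Yy; apply: pmin; rewrite inE.
Qed.

Lemma euclid_proj_in z : Y (euclid_proj Y z).
Proof. exact: (euclid_projP z).1. Qed.

Lemma euclid_proj_1lipschitz z z' :
  norm2 (euclid_proj Y z - euclid_proj Y z') <= norm2 (z - z').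
Proof. exact: euclid_proj_nonexpansive (euclid_projP z) (euclid_projP z'). Qed.

Lemma euclid_proj_id y : Y y -> euclid_proj Y y = y.
Proof.
move=> Yy; apply/eqP; rewrite -subr_eq0; apply/eqP/norm2_eq0.
have [_ /(_ y Yy)] := euclid_projP y.
by rewrite subrr norm2_0 norm2B.
Qed.

End CompactConvex.

End Euclidean.

(** * Brouwer's theorem on compact convex sets *)

Section BrouwerConvex.
Variable R : realType.

Lemma continuous_mx (T : topologicalType) m n (F : T -> 'M[R]_(m, n)) :
  (forall i j, continuous (fun t => F t i j)) -> continuous F.
Proof.
move=> Fc t A [P Pn PA]; apply: filterS (fun t' => PA (F t')) _.
by do 2![apply: filter_forall => ?]; apply: Fc.
Qed.

Lemma continuous_affine (T : topologicalType) (g : T -> R) a b :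
  continuous g -> continuous (fun t => a * g t + b).
Proof.
move=> gc t; have ac : {for t, continuous (fun=> a)} by exact: cst_continuous.
have bc : {for t, continuous (fun=> b)} by exact: cst_continuous.
exact: (continuousD (continuousM ac (gc t)) bc).
Qed.

(** K is placed in an affine copy of the standard simplex, onto which f is
    extended by composing it with the projection on K. *)
Theorem brouwer n (K : set 'cV[R]_n) (f : 'cV[R]_n -> 'cV[R]_n) :
  K !=set0 -> compact K -> convex_set K ->
  {within K, continuous f} -> (forall x, K x -> K (f x)) ->
  exists2 x, K x & f x = x.
Proof.
move=> K0 Kc Kcv fc fK.
have [M M_gt0 KM] := ex_strict_bound_gt0 (compact_bounded Kc).
pose s : R := 2 * M * n%:R + 1.
have s_gt0 : 0 < s by rewrite ltr_pwDr // mulr_ge0 // mulr_ge0 // ltW.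
(* phi maps the standard simplex onto a simplex that contains the cube of radius
   M; psi is its inverse, the coordinate 0 absorbing the remaining mass. *)
pose phi (w : 'rV[R]_n.+1) : 'cV[R]_n := \col_j (s * w 0 (lift ord0 j) - M).
pose psi (x : 'cV[R]_n) : 'rV[R]_n.+1 := \row_i
  if unlift ord0 i is Some j then (x j 0 + M) / s
  else 1 - \sum_j (x j 0 + M) / s.
have psiK x : phi (psi x) = x.
  apply/colP => j; rewrite !mxE liftK mulrCA mulfV ?gt_eqF // mulr1.
  by rewrite addrK.
have psiS x : K x -> simplex (psi x).
  move=> Kx; have xM j : `|x j 0| <= M.
    exact: le_trans (le_mx_norm _ _ _) (ltW (KM _ Kx)).
  have x_ge j : 0 <= (x j 0 + M) / s.
    rewrite divr_ge0 ?(ltW s_gt0) // -lerBlDr sub0r.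
    by have := xM j; rewrite ler_norml => /andP[].
  split=> [i|].
    rewrite mxE; case: unliftP => [j _|_] //.
    rewrite subr_ge0 -mulr_suml ler_pdivrMr // mul1r.
    apply: le_trans (_ : \sum_(j < n) 2 * M <= _).
      apply: ler_sum => j _; have := xM j; rewrite ler_norml => /andP[_].
      by rewrite mulr_natl mulr2n lerD2r.
    by rewrite sumr_const card_ord -[leLHS]mulr_natr lerDl.
  rewrite big_ord_recl mxE unlift_none.
  under [X in _ + X]eq_bigr do rewrite mxE liftK.
  by rewrite subrK.
have phi_c : continuous phi.
  apply: continuous_mx => j k; under eq_fun do rewrite mxE.
  by apply: continuous_affine; apply: coord_continuous.
have psi_c : continuous psi.
  have ac j : continuous (fun x : 'cV[R]_n => (x j 0 + M) / s).
    under eq_fun do rewrite mulrDl mulrC.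
    by apply: continuous_affine; apply: coord_continuous.
  apply: continuous_mx => k i; under eq_fun do rewrite mxE.
  case: unliftP => [j _|_]; first exact: ac.
  have : continuous (fun x : 'cV[R]_n => - 1 * (\sum_j (x j 0 + M) / s) + 1).
    by apply: continuous_affine; apply: continuous_sum.
  by under eq_fun do rewrite mulN1r addrC.
have proj_c : continuous (euclid_proj K).
  apply/continuous_subspace_setT.
  apply: (@norm2_lipschitz_continuous _ _ _ _ _ 1) => u v _ _.
  by rewrite mul1r euclid_proj_1lipschitz.
have fp_c : continuous (f \o euclid_proj K).
  move=> x A /= Afx.
  have /subspace_continuousP/(_ _ (euclid_proj_in K0 Kc x)) := fc.
  move=> /(_ _ Afx)/proj_c; apply: (@filterS _ (nbhs x) (nbhs_filter x)) => y.
  by apply; apply: euclid_proj_in.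
pose g := psi \o (f \o euclid_proj K) \o phi.
have [|w wS|w _ gw] := @brouwer_simplex R n g.
- apply: continuous_subspaceT => w; apply: continuous_comp; first exact: phi_c.
  by apply: continuous_comp; [exact: fp_c|exact: psi_c].
- by apply: psiS; apply: fK; apply: euclid_proj_in.
have fw : f (euclid_proj K (phi w)) = phi w by rewrite -{2}gw psiK.
have Kw : K (phi w) by rewrite -fw; apply: fK; apply: euclid_proj_in.
by exists (phi w); rewrite // -{2}fw euclid_proj_id.
Qed.

End BrouwerConvex.

(** * Spectral norm *)

Section SpectralNorm.
Variables (R : realType) (m n : nat) (A : 'M[R]_(m, n)).

Let image_ball : set R := [set norm2 (A *m v) | v in [set v | norm2 v <= 1]].

Let image_ball0 : image_ball 0.
Proof. by exists 0; rewrite /= ?mulmx0 norm2_0. Qed.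

(** The Frobenius bound; it makes the supremum in [spectral_norm] finite. *)
Lemma norm2_mulmx_frobenius (v : 'cV[R]_n) :
  norm2 (A *m v) <= Num.sqrt (\sum_i norm2 (row i A)^T ^+ 2) * norm2 v.
Proof.
have S0 : 0 <= \sum_i norm2 (row i A)^T ^+ 2.
  by apply: sumr_ge0 => i _; rewrite sqr_ge0.
rewrite -(ler_pXn2r (n := 2)) ?nnegrE ?mulr_ge0 ?norm2_ge0 ?sqrtr_ge0 //.
rewrite (sqr_norm2 (A *m v)) exprMn (sqr_sqrtr S0) mulr_suml.
apply: ler_sum => i _; rewrite -exprMn.
have -> : (A *m v) i 0 = dot (row i A)^T v.
  by rewrite dotE mxE; apply: eq_bigr => j _; rewrite !mxE.
rewrite -[X in X <= _]real_normK ?num_real //.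
rewrite ler_pXn2r ?nnegrE ?mulr_ge0 ?norm2_ge0 // ler_norml.
rewrite cauchy_schwarz andbT.
by rewrite lerNl -dotNr (le_trans (cauchy_schwarz _ _)) // norm2N.
Qed.

Let image_ball_sup : has_sup image_ball.
Proof.
split; first by exists 0.
exists (Num.sqrt (\sum_i norm2 (row i A)^T ^+ 2)) => _ [v v1 <-].
apply: le_trans (norm2_mulmx_frobenius v) _.
by rewrite ler_piMr // sqrtr_ge0.
Qed.

Lemma spectral_norm_ge0 : 0 <= spectral_norm A.
Proof. exact: (sup_upper_bound image_ball_sup). Qed.

Lemma norm2_mulmx (v : 'cV[R]_n) :
  norm2 (A *m v) <= spectral_norm A * norm2 v.
Proof.
have [v0|v_gt0] := leP (norm2 v) 0.
  by rewrite (norm2_eq0 v0) mulmx0 !norm2_0 mulr0.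
rewrite -ler_pdivrMr //; apply: (sup_upper_bound image_ball_sup).
have v_norm : `|(norm2 v)^-1| = (norm2 v)^-1.
  by rewrite ger0_norm // invr_ge0 norm2_ge0.
exists ((norm2 v)^-1 *: v).
  by rewrite /= norm2Z v_norm mulVf ?gt_eqF.
by rewrite -scalemxAr norm2Z v_norm mulrC.
Qed.

End SpectralNorm.

(** * Stacked vectors, feasible sets and policies *)

Section Nodes.
Variables (R : realType) (N : nat).
Implicit Types (z : 'cV[R]_(N + N)) (w : 'I_N -> 'cV[R]_2).

Lemma cV2P (u v : 'cV[R]_2) : u 0 0 = v 0 0 -> u 1 0 = v 1 0 -> u = v.
Proof.
move=> e0 e1; apply/colP => k; have [->|k0] := eqVneq k 0; first exact: e0.
have -> : k = 1 by case: k k0 => -[|[|k]] // ltk _; apply/val_inj.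
exact: e1.
Qed.

Lemma node0 z i : node z i 0 0 = z (lshift N i) 0.
Proof. by rewrite /node /pair2 !mxE. Qed.

Lemma node1 z i : node z i 1 0 = z (rshift N i) 0.
Proof. by rewrite /node /pair2 !mxE. Qed.

Lemma nodeK w i : node (stack w) i = w i.
Proof.
by apply: cV2P; rewrite ?node0 ?node1 /stack ?col_mxEu ?col_mxEd mxE.
Qed.

Lemma stackK z : stack (node z) = z.
Proof.
rewrite -[RHS]vsubmxK /stack; congr col_mx; apply/colP => i.
  by rewrite mxE node0 mxE.
by rewrite mxE node1 mxE.
Qed.

Lemma nodeD z z' i : node (z + z') i = node z i + node z' i.
Proof. by apply: cV2P; rewrite [RHS]mxE !(node0, node1) mxE. Qed.

Lemma nodeZ a z i : node (a *: z) i = a *: node z i.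
Proof. by apply: cV2P; rewrite [RHS]mxE !(node0, node1) mxE. Qed.

Lemma stackB w w' : stack w - stack w' = stack (fun i => w i - w' i).
Proof.
rewrite /stack opp_col_mx add_col_mx; congr col_mx; apply/colP => i;
  by rewrite !mxE.
Qed.

Lemma sqr_norm2_stack w : norm2 (stack w) ^+ 2 = \sum_i norm2 (w i) ^+ 2.
Proof.
rewrite sqr_norm2 big_split_ord /= -big_split /=; apply: eq_bigr => i _.
rewrite sqr_norm2 big_ord_recl big_ord1 /stack col_mxEu col_mxEd !mxE.
by congr (_ + w i _ 0 ^+ 2); apply/val_inj.
Qed.

Section ProductSet.
Variable Yi : 'I_N -> set 'cV[R]_2.

Lemma prod_set_neq0 : (forall i, Yi i !=set0) -> prod_set Yi !=set0.
Proof.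
by move=> /choice[w wY]; exists (stack w) => i; rewrite nodeK.
Qed.

Lemma prod_set_convex :
  (forall i, convex_set (Yi i)) -> convex_set (prod_set Yi).
Proof.
move=> cY x y l; rewrite !inE => Yx Yy i.
have := cY i (node x i) (node y i) l; rewrite !inE => /(_ (Yx i) (Yy i)).
by rewrite /conv /= nodeD !nodeZ.
Qed.

(** The product set is the image of a product of compact sets under [stack]. *)
Lemma prod_set_compact : (forall i, compact (Yi i)) -> compact (prod_set Yi).
Proof.
move=> cY.
pose T : topologicalType := prod_topology (fun _ : 'I_N => 'cV[R]_2).
pose P : set T := [set w | forall i, Yi i (w i)].
have stack_c : continuous (@stack R N : T -> 'cV[R]_(N + N)).
  apply: continuous_mx => k j; rewrite ord1.
  have wc i l : continuous (fun w : T => w i l 0 : R).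
    have pc : continuous (fun w : T => w i : 'cV[R]_2).
      exact: (@proj_continuous 'I_N (fun=> 'cV[R]_2) i).
    have cc : continuous (fun u : 'cV[R]_2 => u l 0) by exact: coord_continuous.
    move=> w; exact: (continuous_comp (pc w) (cc _)).
  case: (split_ordP k) => i ->.
    by under eq_fun do rewrite col_mxEu mxE; apply: wc.
  by under eq_fun do rewrite col_mxEd mxE; apply: wc.
have -> : prod_set Yi = @stack R N @` P.
  apply/seteqP; split=> [z Yz|_ [w Pw <-] i]; last by rewrite nodeK.
  by exists (node z); rewrite ?stackK.
apply: continuous_compact; first exact: continuous_subspaceT.
exact: tychonoff.
Qed.

End ProductSet.

(** The exogenous part of the policy cancels in the difference because of
    separability. *)
Lemma policy_lipschitz (up uq : 'I_N -> R -> R -> R)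
    (utheta : 'I_N -> R -> 'cV[R]_2) (uphi : 'I_N -> 'cV[R]_2 -> 'cV[R]_2)
    (L : 'I_N -> R) d (v v' : 'cV[R]_N) :
  (forall i, separable (up i) (uq i) (utheta i) (uphi i)) ->
  (forall i, 0 <= L i) -> (forall i, lipschitz_pos (L i) (utheta i)) ->
  (forall i, pos_reals (v i 0)) -> (forall i, pos_reals (v' i 0)) ->
  norm2 (policy up uq v d - policy up uq v' d) <=
    \big[Num.max/0]_(i < N) L i * norm2 (v - v').
Proof.
move=> sep L0 Lip v_gt0 v'_gt0; set Lm := \big[_/_]_(_ < _) _.
have Lm0 : 0 <= Lm by apply: bigmax_ge_id.
rewrite -(ler_pXn2r (n := 2)) ?nnegrE ?mulr_ge0 ?norm2_ge0 //.
rewrite /policy stackB sqr_norm2_stack exprMn (sqr_norm2 (v - v')) mulr_sumr.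
apply: ler_sum => i _; rewrite -exprMn !mxE !sep //.
have -> : utheta i (v i 0) + uphi i (node d i) -
    (utheta i (v' i 0) + uphi i (node d i)) =
    utheta i (v i 0) - utheta i (v' i 0).
  by rewrite opprD addrACA subrr addr0.
rewrite -[leRHS]real_normK ?num_real // normrM (ger0_norm Lm0).
rewrite ler_pXn2r ?nnegrE ?mulr_ge0 ?norm2_ge0 //.
apply: le_trans (Lip i _ _ (v_gt0 i) (v'_gt0 i)) _.
by rewrite ler_wpM2r // le_bigmax.
Qed.

(** The factor under the root may a priori be negative (when Y has at most one
    point); the estimate survives because [Num.sqrt] is monotone and vanishes on
    negative numbers. *)
Lemma gradient_step_lipschitz (f : 'I_N -> 'cV[R]_2 -> R)
    (Y : set 'cV[R]_(N + N)) (alpha m xi : R) x y :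
  0 <= alpha -> 0 <= xi -> strongly_convex m f Y -> smooth xi f Y ->
  Y x -> Y y ->
  norm2 ((x - y) - alpha *: (gradf f x - gradf f y)) <=
    Num.sqrt (1 - 2 * alpha * m + alpha ^+ 2 * xi ^+ 2) * norm2 (x - y).
Proof.
move=> a0 xi0 cvx smth Yx Yy; set g := gradf f x - gradf f y.
have gm : m * norm2 (x - y) ^+ 2 <= dot g (x - y) := cvx _ _ Yx Yy.
have gx : norm2 g ^+ 2 <= xi ^+ 2 * norm2 (x - y) ^+ 2.
  rewrite -exprMn ler_pXn2r ?nnegrE ?mulr_ge0 ?norm2_ge0 //; exact: smth.
rewrite -[norm2 (x - y) in leRHS]ger0_norm ?norm2_ge0 //.
rewrite -sqrtr_sqr -[leLHS]ger0_norm ?norm2_ge0 // -[leLHS]sqrtr_sqr.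
rewrite mulrC -sqrtrM ?sqr_ge0 // ler_wsqrtr // sqr_norm2D norm2N norm2Z.
rewrite dotNr dotZr (dotC (x - y)) exprMn real_normK ?num_real //.
have h1 := ler_wpM2l a0 gm; have h2 := ler_wpM2l (sqr_ge0 alpha) gx.
move: (norm2 _ ^+ 2) (dot _ _) (norm2 g ^+ 2) h1 h2 => X D G h1 h2.
rewrite -subr_ge0.
have -> : X * (1 - 2 * alpha * m + alpha ^+ 2 * xi ^+ 2) -
    (X + 2 * - (alpha * D) + alpha ^+ 2 * G) =
    (alpha ^+ 2 * (xi ^+ 2 * X) - alpha ^+ 2 * G) +
    2 * (alpha * D - alpha * (m * X)) by ring.
by rewrite addr_ge0 ?mulr_ge0 ?subr_ge0.
Qed.

End Nodes.

(** * The projected gradient dynamics *)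

Section Dynamics.
Variables (R : realType) (N : nat).
Variables (Y : set 'cV[R]_(N + N)).
Hypotheses (Y0 : Y !=set0) (Yc : compact Y) (Ycv : convex_set Y).
Variables (f : 'I_N -> 'cV[R]_2 -> R) (up uq : 'I_N -> R -> R -> R).
Variables (alpha m xi : R) (A : 'M[R]_(N, N + N)) (venv : 'cV[R]_N).
Variable d : 'cV[R]_(N + N).
Variable utheta : 'I_N -> R -> 'cV[R]_2.
Variable uphi : 'I_N -> 'cV[R]_2 -> 'cV[R]_2.
Variable L : 'I_N -> R.
Hypotheses (alpha_gt0 : 0 < alpha) (xi_gt0 : 0 < xi).
Hypothesis voltage_pos :
  forall z, Y z -> forall i, pos_reals ((A *m z + venv) i 0).
Hypotheses (f_convex : strongly_convex m f Y) (f_smooth : smooth xi f Y).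
Hypothesis u_sep : forall i, separable (up i) (uq i) (utheta i) (uphi i).
Hypothesis L_gt0 : forall i, 0 < L i.
Hypothesis u_lip : forall i, lipschitz_pos (L i) (utheta i).

Let F := dynamics alpha f up uq Y d A venv.

Let Lmax := \big[Num.max/0]_(i < N) L i.

Lemma dynamics_in x : Y (F x).
Proof. exact: euclid_proj_in. Qed.

(** The voltages are positive on Y, so that separability and the Lipschitz
    bounds, which only concern positive voltages, apply. *)
Lemma dynamics_lipschitz x y : Y x -> Y y ->
  norm2 (F x - F y) <=
    (Num.sqrt (1 - 2 * alpha * m + alpha ^+ 2 * xi ^+ 2) +
     alpha * Lmax * spectral_norm A) * norm2 (x - y).
Proof.
move=> Yx Yy; apply: le_trans (euclid_proj_1lipschitz Y0 Yc Ycv _ _) _.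
set ux := policy _ _ _ _; set uy := policy _ _ (A *m y + _) _.
have -> : x - alpha *: (gradf f x + ux) - (y - alpha *: (gradf f y + uy)) =
    (x - y - alpha *: (gradf f x - gradf f y)) + - (alpha *: (ux - uy)).
  by apply/colP => i; rewrite !mxE; ring.
apply: le_trans (ler_norm2D _ _) _; rewrite mulrDl lerD //.
  by apply: gradient_step_lipschitz f_convex f_smooth Yx Yy; apply: ltW.
rewrite norm2N norm2Z gtr0_norm // -!mulrA ler_wpM2l ?(ltW alpha_gt0) //.
apply: le_trans (policy_lipschitz _ u_sep _ u_lip _ _) _.
- by move=> i; apply: ltW.
- exact: voltage_pos.
- exact: voltage_pos.
rewrite ler_wpM2l ?bigmax_ge_id //.
have -> : A *m x + venv - (A *m y + venv) = A *m (x - y).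
  by rewrite mulmxBr opprD addrACA subrr addr0.
exact: norm2_mulmx.
Qed.

Lemma dynamics_fixpoint : exists x, F x = x.
Proof.
have [||x _ Fx] := @brouwer R _ Y F Y0 Yc Ycv; last by exists x.
  exact: norm2_lipschitz_continuous dynamics_lipschitz.
by move=> x _; apply: dynamics_in.
Qed.

Lemma dynamics_fixpoint_unique x y :
  Num.sqrt (1 - 2 * alpha * m + alpha ^+ 2 * xi ^+ 2) +
    alpha * Lmax * spectral_norm A < 1 ->
  F x = x -> F y = y -> x = y.
Proof.
move=> k_lt1 Fx Fy; apply/eqP; rewrite -subr_eq0; apply/eqP/norm2_eq0.
have Yx : Y x by rewrite -Fx; apply: dynamics_in.
have Yy : Y y by rewrite -Fy; apply: dynamics_in.
have := dynamics_lipschitz Yx Yy; rewrite Fx Fy => le_k.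
rewrite leNgt; apply/negP => n_gt0; move: le_k.
by rewrite ler_pMl // leNgt k_lt1.
Qed.

End Dynamics.

Theorem theorem1 (R : realType) (N : nat) (N_gt0 : (0 < N)%N)
  (e : rel 'I_N.+1) (e_tree : tree e) (r x : {set 'I_N.+1} -> R)
  (v0 : R) (pu qu : 'cV[R]_N)
  (Yi : 'I_N -> set 'cV[R]_2)
  (Yi_neq0 : forall i, Yi i !=set0)
  (Yi_compact : forall i, compact (Yi i))
  (Yi_convex : forall i, convex_set (Yi i))
  (f : 'I_N -> 'cV[R]_2 -> R) (up uq : 'I_N -> R -> R -> R)
  (alpha m xi : R) (alpha_gt0 : 0 < alpha) (m_gt0 : 0 < m) (xi_gt0 : 0 < xi) :
  let A := net_mx e r x in
  let venv := v_env e r x v0 pu qu in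
  let d := col_mx pu qu in
  let Y := prod_set Yi in
  let F := dynamics alpha f up uq Y d A venv in
  forall
  (voltage_pos : forall z, Y z -> forall i, pos_reals ((A *m z + venv) i 0))
  (f_C1 : forall i, continuously_differentiable (f i))
  (f_convex : strongly_convex m f Y)
  (f_smooth : smooth xi f Y)
  (utheta : 'I_N -> R -> 'cV[R]_2) (uphi : 'I_N -> 'cV[R]_2 -> 'cV[R]_2)
  (L : 'I_N -> R)
  (C1 : forall i, separable (up i) (uq i) (utheta i) (uphi i))
  (L_gt0 : forall i, 0 < L i)
  (C2 : forall i, lipschitz_pos (L i) (utheta i)),
  [/\ exists xv, equilibrium F A venv xv,
      forall xd vd, equilibrium F A venv (xd, vd) ->
        xd = euclid_proj Y (xd - alpha *: (gradf f xd + policy up uq vd d)) /\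
        vd = A *m xd + venv
    & alpha < 2 * m / xi ^+ 2 ->
      \big[Num.max/0]_(i < N) L i <
        (1 - Num.sqrt (1 - 2 * alpha * m + alpha ^+ 2 * xi ^+ 2)) /
          (alpha * spectral_norm A) ->
      exists! xv, equilibrium F A venv xv].
Proof.
move=> A venv d Y F voltage_pos f_C1 f_convex f_smooth utheta uphi L.
move=> C1 L_gt0 C2.
have Y0 : Y !=set0 by exact: prod_set_neq0.
have Yc : compact Y by exact: prod_set_compact.
have Ycv : convex_set Y by exact: prod_set_convex.
have [x0 Fx0] : exists x0, F x0 = x0.
  exact: (dynamics_fixpoint Y0 Yc Ycv d alpha_gt0 xi_gt0 voltage_pos f_convex
            f_smooth C1 L_gt0 C2).
have eq0 : equilibrium F A venv (x0, A *m x0 + venv) by split.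
split; first by exists (x0, A *m x0 + venv).
  by move=> xd vd [/= Fxd ->]; split=> //; exact: (esym Fxd).
move=> _ C3; exists (x0, A *m x0 + venv); split=> // -[x1 v1] [/= Fx1 ->].
suff -> : x0 = x1 by [].
apply: (dynamics_fixpoint_unique Y0 Yc Ycv alpha_gt0 xi_gt0 voltage_pos
  f_convex f_smooth C1 L_gt0 C2 _ Fx0 Fx1).
set s := Num.sqrt _ in C3 *; set Lm := \big[_/_]_(_ < _) _ in C3 *.
(* If the spectral norm vanishes, the bound on Lm is a quotient by 0, that is 0,
   and Lm < 0 is impossible. *)
have [A0|A_neq0] := eqVneq (spectral_norm A) 0.
  move: C3; rewrite A0 mulr0 invr0 mulr0 ltNge.
  by rewrite (_ : 0 <= Lm) //; apply: bigmax_ge_id.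
have A_gt0 : 0 < spectral_norm A by rewrite lt_def A_neq0 spectral_norm_ge0.
move: C3; rewrite ltr_pdivlMr ?mulr_gt0 // ltrBrDl.
by rewrite mulrA (mulrC Lm).
Qed.
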